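(* If $b\in(0,1)\setminus\{1/2\}$, then there exists a real number $a_b$ such that for every $a>0$ with $a>a_b$ the map $f_{a,b}$ has periodic orbits of all periods (i.e. for every integer $n\ge1$ a periodic orbit of period $n$) and is Li-Yorke chaotic.
   Context: For real $a>0$ and $b\in(0,1)$, the map $f_{a,b}:[0,1]\to[0,1]$ is defined by $$f_{a,b}(x)=\frac{x}{x+(1-x)\exp(a(x-b))}.$$ The period of a periodic orbit is its minimal period, i.e. its number of points. Li-Yorke chaos: let $X$ be a compact space with metric $\rho$ and $f:X\to X$ a continuous map. A pair of points $x,y\in X$ is a Li-Yorke pair if $\liminf_{n\to\infty}\rho(f^n(x),f^n(y))=0$ and $\limsup_{n\to\infty}\rho(f^n(x),f^n(y))>0$. The map $f$ is Li-Yorke chaotic if there is an uncountable set $S\subset X$ such that every pair $(x,y)$ with $x,y\in S$ and $x\ne y$ is a Li-Yorke pair. Here $X=[0,1]$ with the usual metric. *)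

(* Defs.v *)
From HB Require Import structures.
From mathcomp Require Import all_boot all_order all_algebra.
From mathcomp Require Import all_classical all_reals all_analysis.

Set Implicit Arguments.
Unset Strict Implicit.
Unset Printing Implicit Defensive.

Import Order.TTheory GRing.Theory Num.Theory.
Import numFieldNormedType.Exports.

Local Open Scope classical_set_scope.
Local Open Scope ring_scope.

(* A self-map of a space X is represented by a total function f on an ambient
   type T together with X : set T; only the values of f on X matter, since X
   is invariant under f. *)

Definition periodic_orbit (T : Type) (X : set T) (f : T -> T) (n : nat)
    (O : set T) : Prop :=
  exists x : T,
    [/\ X x, (0 < n)%N, iter n f x = x,
        (forall k : nat, (0 < k < n)%N -> iter k f x <> x) &
        O = [set iter k f x | k in `I_n]].

Definition li_yorke_pair (R : realType) (T : Type) (rho : T -> T -> R)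
    (f : T -> T) (x y : T) : Prop :=
  let d := fun n : nat => (rho (iter n f x) (iter n f y))%:E in
  limn_einf d = 0%E /\ (0 < limn_esup d)%E.

Definition li_yorke_chaotic (R : realType) (T : Type) (rho : T -> T -> R)
    (X : set T) (f : T -> T) : Prop :=
  exists S : set T,
    [/\ S `<=` X, ~ countable S &
        forall x y : T, S x -> S y -> x <> y -> li_yorke_pair rho f x y].

Definition fab (R : realType) (a b x : R) : R :=
  x / (x + (1 - x) * expR (a * (x - b))).

Lemma fab_den_gt0 (R : realType) (a b x : R) :
  `[0, 1]%classic x -> 0 < x + (1 - x) * expR (a * (x - b)).
Proof.
rewrite /= in_itv /= => /andP[x0 x1].
have e0 := expR_gt0 (a * (x - b)).
have [->|xn0] := eqVneq x 0; first by rewrite add0r subr0 mul1r expR_gt0.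
by rewrite ltr_wpDr ?lt0r ?xn0// mulr_ge0 ?subr_ge0// ltW.
Qed.

Lemma fab_set_fun (R : realType) (a b : R) :
  set_fun `[0, 1]%classic `[0, 1]%classic (fab a b).
Proof.
move=> x x01; have d0 := fab_den_gt0 a b x01.
move: x01; rewrite /= !in_itv /= => /andP[x0 x1].
rewrite /fab divr_ge0 ?(ltW d0)//= ler_pdivrMr// mul1r lerDl.
by rewrite mulr_ge0 ?subr_ge0// expR_ge0.
Qed.

Lemma fab_continuous (R : realType) (a b : R) :
  {within `[0, 1]%classic, continuous (fab a b)}.
Proof.
apply: continuous_in_subspaceT => x; rewrite inE => x01.
apply: cvgM; first exact: cvg_id.
apply: cvgV; first by rewrite gt_eqF// fab_den_gt0.
apply: cvgD; first exact: cvg_id.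
apply: cvgM; first by apply: cvgB; [exact: cvg_cst|exact: cvg_id].
apply: continuous_comp; last exact: continuous_expR.
apply: cvgM; first exact: cvg_cst.
by apply: cvgB; [exact: cvg_id|exact: cvg_cst].
Qed.

(* Main.v *)
(* Assume b < 1/2 (the case b > 1/2 follows by the conjugacy x -> 1 - x). In the
   coordinate u = log(x/(1-x)), f is the map u -> u - a (x - b). Hence, for large
   a, the interval J = [b/2, 3/4 + b/2] around the fixed point b and the interval
   K = [exp(-a/2), b/4] to its left are such that f(J) contains J and K, and f(K)
   contains J. Orbits which are in J at times 0, ..., n, in K at time n + 1 and
   then close up give a point of period n + 2.

   For chaos, the points of J that stay in J up to time n and are in K at time
   n + 1 contain an interval D_n; these can be chosen as disjoint intervals, so
   that their lengths tend to 0. By compactness there are orbits which visit D_0,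
   D_1, D_2, ... at prescribed times and, between D_i and D_(i+1), are in K or in
   J at a prescribed time according to an arbitrary bit. Two such orbits are
   arbitrarily close when they are in the same D_i, and far apart when their bits
   differ. *)
Require Import Defs.
From mathcomp Require Import all_boot all_order all_algebra.
From mathcomp Require Import all_classical all_reals all_analysis.
From mathcomp Require Import ring lra zify.

Set Implicit Arguments.
Unset Strict Implicit.
Unset Printing Implicit Defensive.

Import Order.TTheory GRing.Theory Num.Theory.
Import numFieldNormedType.Exports.

Local Open Scope classical_set_scope.
Local Open Scope ring_scope.

(** * Intermediate values and covering relations between intervals *)

Lemma ex_max_compact (R : realType) (A : set R) :
  A !=set0 -> compact A -> exists2 c, A c & forall t, A t -> t <= c.
Proof.
move=> A0 cA.
have [|c cA' cmax] := @compact_EVT_max R R idfun A A0 cA.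
  by apply: continuous_subspaceT => x; exact: cvg_id.
by exists c => [|t At]; [rewrite inE in cA'|apply: cmax; rewrite inE].
Qed.

Lemma ex_min_compact (R : realType) (A : set R) :
  A !=set0 -> compact A -> exists2 c, A c & forall t, A t -> c <= t.
Proof.
move=> A0 cA.
have [|c cA' cmin] := @compact_EVT_min R R idfun A A0 cA.
  by apply: continuous_subspaceT => x; exact: cvg_id.
by exists c => [|t At]; [rewrite inE in cA'|apply: cmin; rewrite inE].
Qed.

Lemma compact_itv_fiber (R : realType) (f : R -> R) (a b u : R) :
  continuous f -> compact (`[a, b] `&` f @^-1` [set u]).
Proof.
move=> cf; apply: compact_closedI; first exact: segment_compact.
by apply: preimage_closed => [x _|]; [exact: cf|exact: closed_eq].
Qed.

Lemma IVT_image (R : realType) (f : R -> R) (a b u v : R) : continuous f ->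
  a <= b -> f a <= u -> v <= f b -> `[u, v] `<=` f @` `[a, b].
Proof.
move=> cf ab fa fb y; rewrite /= in_itv /= => /andP[uy yv].
have [||c cab fc] := @IVT R f a b y ab.
- exact: continuous_subspaceT.
- by rewrite ge_min le_max (le_trans fa uy) (le_trans yv fb) orbT.
- by exists c.
Qed.

Lemma IVT_image_decr (R : realType) (f : R -> R) (a b u v : R) : continuous f ->
  a <= b -> v <= f a -> f b <= u -> `[u, v] `<=` f @` `[a, b].
Proof.
move=> cf ab fa fb y; rewrite /= in_itv /= => /andP[uy yv].
have [||c cab fc] := @IVT R f a b y ab.
- exact: continuous_subspaceT.
- by rewrite ge_min le_max (le_trans fb uy) (le_trans yv fa) !orbT.
- by exists c.
Qed.

(* Between the last solution of [f x = u] in [a, b] and the first solution of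
   [f x = v] after it, [f] stays in [u, v]. *)
Lemma ex_subitv_image_eq_le (R : realType) (f : R -> R) (a b u v : R) :
  continuous f -> a <= b -> u <= v -> f a = u -> f b = v ->
  exists a' b', [/\ a' <= b', `[a', b'] `<=` `[a, b] &
    f @` `[a', b'] = `[u, v]%classic].
Proof.
move=> cf ab uv fa fb.
have [|a' [/= + fa'] a'max] := ex_max_compact _ (@compact_itv_fiber _ f a b u cf).
  by exists a; rewrite /= in_itv /= lexx.
rewrite in_itv /= => /andP[aa' a'b].
have [|b' [/= + fb'] b'min] := ex_min_compact _ (@compact_itv_fiber _ f a' b v cf).
  by exists b; rewrite /= in_itv /= lexx a'b.
rewrite in_itv /= => /andP[a'b' b'b].
exists a', b'; split=> //.
  move=> x; rewrite /= !in_itv /= => /andP[a'x xb'].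
  by rewrite (le_trans aa') // (le_trans xb').
apply/seteqP; split; last by apply: IVT_image; rewrite ?fa' ?fb'.
move=> _ [x + <-]; rewrite /= !in_itv /= => /andP[a'x xb'].
apply/andP; split; rewrite leNgt; apply/negP => fx.
- have ufb : u <= f b' by rewrite fb'.
  have [|c] := IVT_image cf xb' (ltW fx) ufb (t := u).
    by rewrite /= in_itv /= lexx.
  rewrite /= in_itv /= => /andP[xc cb'] fc.
  have /a'max ca' : (`[a, b] `&` f @^-1` [set u]) c.
    split=> //=.
    by rewrite in_itv /= (le_trans aa' (le_trans a'x xc)) (le_trans cb').
  have xa' : x = a' by lra.
  by move: fx; rewrite xa' fa' ltxx.
- have fav : f a' <= v by rewrite fa'.
  have [|c] := IVT_image cf a'x fav (ltW fx) (t := v).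
    by rewrite /= in_itv /= lexx.
  rewrite /= in_itv /= => /andP[a'c cx] fc.
  have /b'min b'c : (`[a', b] `&` f @^-1` [set v]) c.
    by split=> //=; rewrite in_itv /= a'c (le_trans cx (le_trans xb' b'b)).
  have xb : x = b' by lra.
  by move: fx; rewrite xb fb' ltxx.
Qed.

Lemma ex_subitv_image_eq (R : realType) (f : R -> R) (a b u v : R) :
  continuous f -> u <= v -> `[u, v] `<=` f @` `[a, b] ->
  exists a' b', [/\ a' <= b', `[a', b'] `<=` `[a, b] &
    f @` `[a', b'] = `[u, v]%classic].
Proof.
move=> cf uv sub.
have [|x + fx] := sub u; first by rewrite /= in_itv /= lexx.
have [|y + fy] := sub v; first by rewrite /= in_itv /= lexx uv.
rewrite /= !in_itv /= => /andP[ay yb] /andP[ax xb].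
have [xy|/ltW yx] := leP x y.
  have [a' [b' [ab' sub' im]]] := ex_subitv_image_eq_le cf xy uv fx fy.
  exists a', b'; split=> //; apply: subset_trans sub' _ => z.
  by rewrite /= !in_itv /= => /andP[xz zy]; rewrite (le_trans ax) // (le_trans zy).
(* Here [v] is attained to the left of [u]; passing to [- f] restores the order. *)
have cnf : continuous (fun z => - f z) by move=> z; apply: cvgN; exact: cf.
have [nvu ny nx] : [/\ - v <= - u, - f y = - v & - f x = - u].
  by rewrite lerN2 fx fy.
have [a' [b' [ab' sub' im]]] := ex_subitv_image_eq_le cnf yx nvu ny nx.
exists a', b'; split=> //.
  apply: subset_trans sub' _ => z.
  by rewrite /= !in_itv /= => /andP[xz zy]; rewrite (le_trans ay) // (le_trans zy).
apply/seteqP; split=> [_ [z zab <-]|z].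
  have : `[- v, - u]%classic (- f z) by rewrite -im; exists z.
  by rewrite /= !in_itv /= !lerN2 andbC.
rewrite /= in_itv /= => zuv.
have : `[- v, - u]%classic (- z) by rewrite /= !in_itv /= !lerN2 andbC.
by rewrite -im => -[w wab /oppr_inj <-]; exists w.
Qed.

(** A preimage of [a] satisfies [f x <= x] and a preimage of [b] satisfies [y <= f y], so [f z - z]
    vanishes between them. *)
Lemma fixed_point_subset_image (R : realType) (f : R -> R) (a b : R) :
  continuous f -> a <= b -> `[a, b] `<=` f @` `[a, b] ->
  exists2 x, `[a, b]%classic x & f x = x.
Proof.
move=> cf ab sub.
have [|x + fx] := sub a; first by rewrite /= in_itv /= lexx.
have [|y + fy] := sub b; first by rewrite /= in_itv /= lexx ab.
rewrite /= !in_itv /= => /andP[ay yb] /andP[ax xb].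
pose g z := f z - z.
have cg : continuous g by move=> z; apply: cvgB; [exact: cf|exact: cvg_id].
have [xy|/ltW yx] := leP x y.
- have [gx gy] : g x <= 0 /\ 0 <= g y by rewrite /g fx fy subr_le0 subr_ge0.
  have [|c] := IVT_image cg xy gx gy (t := 0).
    by rewrite /= in_itv /= lexx.
  rewrite /= in_itv /= => /andP[xc cy] /eqP; rewrite subr_eq0 => /eqP fc.
  by exists c => //; rewrite in_itv /= (le_trans ax xc) (le_trans cy).
- have [gx gy] : g x <= 0 /\ 0 <= g y by rewrite /g fx fy subr_le0 subr_ge0.
  have [|c] := IVT_image_decr cg yx gy gx (t := 0).
    by rewrite /= in_itv /= lexx.
  rewrite /= in_itv /= => /andP[yc cx] /eqP; rewrite subr_eq0 => /eqP fc.
  by exists c => //; rewrite in_itv /= (le_trans ay yc) (le_trans cx).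
Qed.

(** * Orbits with a prescribed itinerary *)

Lemma nested_compact_nonempty (T : topologicalType) (A : nat -> set T) :
  compact (A 0%N) -> (forall n, closed (A n)) -> (forall n, A n !=set0) ->
  (forall n, A n.+1 `<=` A n) -> exists x, forall n, A n x.
Proof.
move=> cA clA A0 Adec.
have /choice[x xA] : forall n, exists x, A n x by move=> n; have [x] := A0 n; exists x.
have Amono m n : (m <= n)%N -> A n `<=` A m.
  by elim: n => [|n IH]; [rewrite leqn0 => /eqP ->|
    rewrite leq_eqVlt => /predU1P[-> //|/IH sub]; exact: subset_trans (Adec n) sub].
have nA m : (x @ \oo) (A m).
  by exists m => // n /= mn; exact: (Amono _ _ mn).
have [c [_ cl]] := cA (x @ \oo) _ (nA 0%N).
by exists c => n; apply: clA => B /cl; apply; exact: nA.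
Qed.

Lemma continuous_iter (T : topologicalType) (f : T -> T) n :
  continuous f -> continuous (iter n f).
Proof.
move=> cf; elim: n => [|n IH] x; first exact: cvg_id.
by apply: (@continuous_comp _ _ _ (iter n f) f); [exact: IH|exact: cf].
Qed.

(** The points that obey the first constraints form a decreasing sequence of compact sets, nonempty
    by pulling back along the coverings. The set [E n] is visited after [m 0 + ... + m (n - 1)]
    steps. *)
Lemma exists_itinerary (R : realType) (f : R -> R) (m : nat -> nat)
    (E : nat -> set R) : continuous f ->
  (forall n, compact (E n)) -> (forall n, E n !=set0) ->
  (forall n, E n.+1 `<=` iter (m n) f @` E n) ->
  exists x, forall n, E n (iter (\sum_(i < n) m i)%N f x).
Proof.
move=> cf cE E0 sub.
pose A n := [set x | forall i, (i <= n)%N -> E i (iter (\sum_(j < i) m j)%N f x)].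
(* Nonemptiness of [A n] alone would not carry the induction: every point of [E n] has to be reached
   from [A n]. *)
have EA n : E n `<=` iter (\sum_(j < n) m j)%N f @` A n.
  elim: n => [|n IH] y Ey.
    exists y; last by rewrite big_ord0.
    by move=> i; rewrite leqn0 => /eqP ->; rewrite big_ord0.
  have [z /IH[x Ax xz] zy] := sub _ _ Ey.
  have ny : iter (\sum_(j < n.+1) m j)%N f x = y.
    by rewrite big_ord_recr /= addnC iterD xz.
  exists x => // i; rewrite leq_eqVlt => /predU1P[->|]; first by rewrite ny.
  exact: Ax.
have clA n : closed (A n).
  rewrite (_ : A n = \bigcap_(i in [set i | (i <= n)%N])
      (iter (\sum_(j < i) m j)%N f @^-1` E i)); last by apply/seteqP; split.
  apply: closed_bigI => i _; apply: preimage_closed.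
    by move=> x _; exact: continuous_iter.
  by apply: compact_closed; [exact: Rhausdorff|exact: cE].
have cA0 : compact (A 0%N).
  rewrite (_ : A 0%N = E 0%N) //; apply/seteqP; split=> [x /(_ 0%N)|x Ex i].
    by rewrite big_ord0; exact.
  by rewrite leqn0 => /eqP ->; rewrite big_ord0.
have A0 n : A n !=set0 by have [y /EA[x Ax _]] := E0 n; exists x.
have decA n : A n.+1 `<=` A n by move=> x Ax i ile; exact/Ax/leqW.
by have [x xA] := nested_compact_nonempty cA0 clA A0 decA; exists x => n; exact: xA.
Qed.

(** * Lower and upper limits, and lengths of disjoint intervals *)

Lemma limn_einf_eq0 (R : realType) (r : nat -> R) : (forall n, 0 <= r n) ->
  (forall e, 0 < e -> forall m, exists2 n, (m <= n)%N & r n <= e) ->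
  limn_einf (fun n => (r n)%:E) = 0%E.
Proof.
move=> r0 small; rewrite limn_einf_lim.
rewrite (_ : einfs _ = cst 0%E); first exact: lim_cst.
apply/funext => m /=; apply/eqP; rewrite eq_le; apply/andP; split; last first.
  by apply: le_ereal_inf_tmp => _ [n /= _ <-]; rewrite lee_fin.
apply/lee_addgt0Pr => e e0; rewrite add0e.
have [n mn rn] := small _ e0 m.
by apply: ge_ereal_inf; exists (r n)%:E; [exists n|rewrite lee_fin].
Qed.

Lemma limn_esup_gt0 (R : realType) (r : nat -> R) (d : R) : 0 < d ->
  (forall m, exists2 n, (m <= n)%N & d <= r n) ->
  (0 < limn_esup (fun n => (r n)%:E))%E.
Proof.
move=> d0 large; rewrite limn_esup_lim.
apply: (@lt_le_trans _ _ d%:E); first by rewrite lte_fin.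
apply: lime_ge; first exact: is_cvg_esups.
apply: nearW => m; have [n mn rn] := large m.
by apply: (@le_trans _ _ (r n)%:E); [rewrite lee_fin|apply: ereal_sup_ubound; exists n].
Qed.

Lemma disjoint_subitv_length (R : realType) (s t a b c d : R) :
  a <= b -> c <= d -> `[a, b] `<=` `[s, t] -> `[c, d] `<=` `[s, t] ->
  (forall x, `[a, b]%classic x -> `[c, d]%classic x -> False) ->
  (b - a) + (d - c) <= t - s.
Proof.
move=> ab cd sub1 sub2 disj.
have in1 x : a <= x -> x <= b -> s <= x /\ x <= t.
  by move=> ax xb; apply/andP; have := sub1 x; rewrite /= !in_itv /= ax xb; apply.
have in2 x : c <= x -> x <= d -> s <= x /\ x <= t.
  by move=> ax xb; apply/andP; have := sub2 x; rewrite /= !in_itv /= ax xb; apply.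
have [] := in1 a _ _; rewrite ?lexx // => sa at_.
have [] := in1 b _ _; rewrite ?lexx // => sb bt.
have [] := in2 c _ _; rewrite ?lexx // => sc ct.
have [] := in2 d _ _; rewrite ?lexx // => sd dt.
have [bc|cb] := ltP b c; first by lra.
have [da|ad] := ltP d a; first by lra.
(* If neither interval lies to the left of the other, the larger left endpoint is in both. *)
by have [ac|ca] := leP a c; exfalso; [apply: (disj c)|apply: (disj a)];
  rewrite /= in_itv /=; lra.
Qed.

(** * Periodic points and scrambled sets from a horseshoe *)

(** The transition graph is J to J, J to K, K to J, with J = [p, q] and K = [k, l]. Either order of
    J and K is allowed, so that reflected horseshoes also qualify. *)
Record horseshoe (R : realType) (f : R -> R) (p q k l : R) : Prop := Horseshoe {
  horseshoe_le1 : p <= q;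
  horseshoe_le2 : k <= l;
  horseshoe_disjoint : l < p \/ q < k;
  horseshoe11 : `[p, q] `<=` f @` `[p, q];
  horseshoe12 : `[k, l] `<=` f @` `[p, q];
  horseshoe21 : `[p, q] `<=` f @` `[k, l] }.

Section Horseshoe.
Variables (R : realType) (f : R -> R) (p q k l : R).
Hypotheses (cf : continuous f) (hf : horseshoe f p q k l).

Let J : set R := `[p, q]%classic.
Let K : set R := `[k, l]%classic.

Lemma horseshoe_gap : exists2 d : R, 0 < d & forall x y, J x -> K y -> d <= `|x - y|.
Proof.
case: (horseshoe_disjoint hf) => [lp|qk].
  exists (p - l); first by rewrite subr_gt0.
  move=> x y; rewrite /J /K /= !in_itv /= => /andP[px xq] /andP[ky yl].
  by apply: le_trans (ler_norm _); rewrite lerB.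
exists (k - q); first by rewrite subr_gt0.
move=> x y; rewrite /J /K /= !in_itv /= => /andP[px xq] /andP[ky yl].
by rewrite distrC; apply: le_trans (ler_norm _); rewrite lerB.
Qed.

Lemma horseshoe_notin x : J x -> K x -> False.
Proof.
move=> Jx Kx; have [d d0 /(_ _ _ Jx Kx)] := horseshoe_gap.
by rewrite subrr normr0 leNgt d0.
Qed.

(* Points of [c n] are in [J] up to time [n], and those of [d n] are then in [K]. *)
Lemma horseshoe_cylinders : exists c d : nat -> R * R,
  [/\ c 0%N = (p, q),
      forall n, (c n).1 <= (c n).2 /\ (d n).1 <= (d n).2,
      forall n, `[(c n.+1).1, (c n.+1).2] `<=` `[(c n).1, (c n).2] /\
                `[(d n).1, (d n).2] `<=` `[(c n).1, (c n).2],
      forall n, iter n f @` `[(c n).1, (c n).2] = J &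
      forall n, iter n.+1 f @` `[(d n).1, (d n).2] = K].
Proof.
have [pq kl _ JJ JK _] := hf.
pose P n (w : R * R) := w.1 <= w.2 /\ iter n f @` `[w.1, w.2] = J.
have image_succ n w : P n w -> iter n.+1 f @` `[w.1, w.2] = f @` J.
  by move=> [_ <-]; rewrite -image_comp.
have ex_c (nw : nat * (R * R)) : exists w : R * R, P nw.1 nw.2 ->
    P nw.1.+1 w /\ `[w.1, w.2] `<=` `[nw.2.1, nw.2.2].
  (* The pair [(0, 0)] is a dummy value that makes the choice function total. *)
  case: (pselect (P nw.1 nw.2)) => [Pw|]; last by exists (0, 0).
  have sub : `[p, q] `<=` iter nw.1.+1 f @` `[nw.2.1, nw.2.2].
    by rewrite image_succ.
  have [u [v [uv uvw im]]] :=
    ex_subitv_image_eq (continuous_iter (n := nw.1.+1) cf) pq sub.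
  by exists (u, v).
have ex_d (nw : nat * (R * R)) : exists w : R * R, P nw.1 nw.2 ->
    [/\ w.1 <= w.2, `[w.1, w.2] `<=` `[nw.2.1, nw.2.2] &
        iter nw.1.+1 f @` `[w.1, w.2] = K].
  case: (pselect (P nw.1 nw.2)) => [Pw|]; last by exists (0, 0).
  have sub : `[k, l] `<=` iter nw.1.+1 f @` `[nw.2.1, nw.2.2].
    by rewrite image_succ.
  have [u [v [uv uvw im]]] :=
    ex_subitv_image_eq (continuous_iter (n := nw.1.+1) cf) kl sub.
  by exists (u, v).
have [gc gcP] := choice ex_c; have [gd gdP] := choice ex_d.
pose c := fix c n := if n is m.+1 then gc (m, c m) else (p, q).
have Pc n : P n (c n).
  elim: n => [|n IH]; last by have [] := gcP (n, c n) IH.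
  by split=> //=; rewrite image_id.
exists c, (fun n => gd (n, c n)); split=> // n.
- by have [? _ _] := gdP (n, c n) (Pc n); have [] := Pc n.
- by have [_ ? _] := gdP (n, c n) (Pc n); have [] := gcP (n, c n) (Pc n).
- by have [] := Pc n.
- by have [] := gdP (n, c n) (Pc n).
Qed.

Lemma horseshoe_excursions : exists u v : nat -> R,
  [/\ forall n, u n <= v n,
      forall n x, `[u n, v n]%classic x -> forall i, (i <= n)%N -> J (iter i f x),
      forall n, iter n.+1 f @` `[u n, v n] = K &
      forall e, 0 < e -> forall m, exists2 n, (m <= n)%N & v n - u n <= e].
Proof.
have [c [d [c0 cd sub imc imd]]] := horseshoe_cylinders.
exists (fun n => (d n).1), (fun n => (d n).2); split=> [n|n x dx i i_n|//|e e0 m].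
- by have [] := cd n.
- have cmono j : `[(c (i + j)%N).1, (c (i + j)%N).2] `<=` `[(c i).1, (c i).2].
    elim: j => [|j IH]; first by rewrite addn0.
    by rewrite addnS; apply: subset_trans IH; have [] := sub (i + j)%N.
  have cx : `[(c i).1, (c i).2]%classic x.
    by apply: (cmono (n - i)%N); rewrite subnKC //; have [_] := sub n; apply.
  by rewrite -(imc i); exists x.
- (* [d n] and [c n.+1] are disjoint in [c n], so the lengths of the [d n] are
     bounded by the decrements of the lengths of the [c n]. *)
  have len n : ((d n).2 - (d n).1) + ((c n.+1).2 - (c n.+1).1) <= (c n).2 - (c n).1.
    have [[_ le_d] [le_c _] [sub_c sub_d]] := And3 (cd n) (cd n.+1) (sub n).
    apply: (disjoint_subitv_length le_d le_c sub_d sub_c) => x dx cx.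
    apply: (@horseshoe_notin (iter n.+1 f x)).
      by rewrite -(imc n.+1); exists x.
    by rewrite -(imd n); exists x.
  (* Otherwise every step from [m] on shortens [c] by at least [e], which exhausts the length of
     [c m] after finitely many steps. *)
  have [//|big] := pselect (exists2 n, (m <= n)%N & (d n).2 - (d n).1 <= e).
  have {}big n : e <= (d (m + n)%N).2 - (d (m + n)%N).1.
    rewrite leNgt; apply/negP => /ltW small; apply: big.
    by exists (m + n)%N => //; exact: leq_addr.
  have dec n : n%:R * e <= (c m).2 - (c m).1 - ((c (m + n)%N).2 - (c (m + n)%N).1).
    elim: n => [|n IH]; first by rewrite mul0r addn0 subrr.
    rewrite -natr1 mulrDl mul1r addnS; have := len (m + n)%N; have := big n; lra.
  have := dec (Num.truncn (((c m).2 - (c m).1) / e)).+1.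
  have := truncnS_gt (((c m).2 - (c m).1) / e).
  rewrite ltr_pdivrMr //.
  by have [+ _] := cd (m + (Num.truncn (((c m).2 - (c m).1) / e)).+1)%N; lra.
Qed.

(** For period n + 2, the iterate of that order maps [[u n, v n]] over J, hence over itself. A
    smaller period [i] would identify the point at time n + 1, in K, with the one at time n + 1 - i,
    in J. *)
Lemma horseshoe_periodic n : (0 < n)%N -> exists x,
  [/\ J x, iter n f x = x & forall i, (0 < i < n)%N -> iter i f x <> x].
Proof.
case: n => [//|[|n]] _.
  have [x Jx fx] := fixed_point_subset_image cf (horseshoe_le1 hf) (horseshoe11 hf).
  by exists x; split=> // -[|[]].
have [u [v [uv stay im _]]] := horseshoe_excursions.
have [|x dx fx] := fixed_point_subset_image (continuous_iter (n := n.+2) cf) (uv n).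
  have -> : iter n.+2 f = f \o iter n.+1 f by [].
  rewrite -image_comp im => x dx; apply: (horseshoe21 hf).
  exact: (stay n x dx 0%N).
exists x; split=> //; first exact: (stay n x dx 0%N).
move=> i /andP[i0 i_n] fix_.
apply: (@horseshoe_notin (iter n.+1 f x)); last first.
  by rewrite -(im n); exists x.
have -> : iter n.+1 f x = iter (n.+1 - i) f x.
  by rewrite -{1}(subnK (m := i) (n := n.+1)) // iterD fix_.
by apply: stay dx _ _; lia.
Qed.

Lemma horseshoe_scrambled : exists S : set R,
  [/\ S `<=` J, ~ countable S &
      forall x y, S x -> S y -> x <> y ->
        li_yorke_pair (fun x y : R => `|x - y|) f x y].
Proof.
have [u [v [uv stay im small]]] := horseshoe_excursions.
have [pq kl _ JJ JK KJ] := hf.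
pose A (b : bool) := if b then K else J.
have AJ b : A b `<=` f @` J by case: b.
have JA b : J `<=` f @` A b by case: b.
have clA b : closed (A b) by case: b; exact: itv_closed.
(* [logn 2] takes every value infinitely often, so the orbits of two points with
   distinct codes [t] are separated infinitely often. *)
pose E (t : nat -> bool) i :=
  `[u i, v i]%classic `&` iter i.+3 f @^-1` A (t (logn 2 i)).
have dJ i : `[u i, v i] `<=` J by move=> x dx; exact: (stay i x dx 0%N).
(* Block [i] runs backwards from [y] in J at time i + 4: [z] in J or K according to the bit, [w] in
   J, [w'] in K, then [x] in [[u i, v i]]. *)
have imE t i : J `<=` iter i.+4 f @` E t i.
  move=> y /(JA (t (logn 2 i)))[z Az zy].
  have [w /KJ Kw wz] : (f @` J) z by exact: AJ Az.
  have [w' Kw' w'w] := Kw; move: Kw'; rewrite -/K -(im i) => -[x dx xw'].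
  have xz : iter i.+3 f x = z by rewrite -wz -w'w -xw'.
  by exists x; [split=> //=; rewrite -[f _]/(iter i.+3 f x) xz | rewrite iterS xz].
have E0 t i : E t i !=set0.
  have [|x Ex _] := imE t i p; first by rewrite /J /= in_itv /= lexx.
  by exists x.
have cE t i : compact (E t i).
  apply: compact_closedI; first exact: segment_compact.
  by apply: preimage_closed => [x _|]; [exact: continuous_iter|exact: clA].
(* The starting time of block [i]. *)
pose T i := (\sum_(j < i) j.+4)%N.
have leT i : (i <= T i)%N.
  by rewrite /T; elim: i => [//|i IH]; rewrite big_ord_recr /=; lia.
have /choice[x xE] t : exists x, forall i, E t i (iter (T i) f x).
  apply: (@exists_itinerary _ f (fun i => i.+4)) => // i.
  by apply: subset_trans (imE t i) => y [/dJ].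
have [d d0 gap] := horseshoe_gap.
have apart t t' : t <> t' -> forall m, exists2 n, (m <= n)%N &
    d <= `|iter n f (x t) - iter n f (x t')|.
  move=> tt' m.
  have [j tj] : exists j, t j != t' j.
    apply: contrapT => /forallNP same; apply: tt'; apply/funext => j.
    by have /negP := same j; rewrite negbK => /eqP.
  (* The odd factor makes [i] at least [m] while its 2-adic valuation stays [j]. *)
  pose i := (2 ^ j * m.*2.+1)%N.
  have logi : logn 2 i = j.
    by rewrite lognM ?expn_gt0 // pfactorK // lognE dvdn2 /= odd_double addn0.
  exists (i.+3 + T i)%N.
    have : (m <= i)%N.
      by apply: leq_trans (leq_pmull _ _); rewrite ?expn_gt0 //; lia.
    by have := leT i; lia.
  rewrite !iterD; have [_ +] := xE t i; have [_ +] := xE t' i.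
  rewrite /preimage /mkset logi.
  move: tj; case: (t j); case: (t' j) => // _ At' At.
    by rewrite distrC; apply: gap.
  exact: gap.
have close t t' e : 0 < e -> forall m, exists2 n, (m <= n)%N &
    `|iter n f (x t) - iter n f (x t')| <= e.
  move=> e0 m; have [i mi vu] := small e e0 m.
  exists (T i); first exact: leq_trans (leT i).
  have [+ _] := xE t i; have [+ _] := xE t' i.
  rewrite /= !in_itv /= => /andP[? ?] /andP[? ?].
  by rewrite ler_norml; apply/andP; split; lra.
exists (range x); split.
- by move=> _ [t _ <-]; apply: (dJ 0%N); have [+ _] := xE t 0%N; rewrite /T big_ord0.
- move=> /countable_injP[g g_inj].
  have x_inj t t' : x t = x t' -> t = t'.
    move=> xtt'; apply: contrapT => /apart/(_ 0%N)[n _].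
    by rewrite xtt' subrr normr0 leNgt d0.
  (* Cantor's diagonal argument: [D] differs from the code numbered [n] at place [n]. *)
  pose D n := `[< exists2 t : nat -> bool, g (x t) = n & ~~ t n >].
  have [Dn|Dn] := boolP (D (g (x D))).
    have /asboolP[t gt tn] := Dn.
    have : t = D by apply/x_inj/g_inj; rewrite ?inE.
    by move=> tD; move: tn; rewrite -gt tD Dn.
  by move/negP: (Dn); apply; apply/asboolP; exists D.
- move=> _ _ [t _ <-] [t' _ <-] xtt'; split.
    by apply: limn_einf_eq0 => // e; exact: close.
  by apply: (limn_esup_gt0 d0); apply: apart => tt'; apply: xtt'; rewrite tt'.
Qed.

End Horseshoe.

(** * Estimates for [fab] with large [a] *)

Lemma near_pinfty_expRN_le (R : realType) (c e : R) : 0 < c -> 0 < e ->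
  \forall a \near +oo, expR (- (a * c)) <= e.
Proof.
move=> c0 e0; exists (e^-1 / c); split; first exact: num_real.
move=> a; rewrite ltr_pdivrMr // => /ltW ac.
rewrite expRN invf_ple ?posrE ?expR_gt0 //.
by apply: le_trans ac _; apply: le_trans (expR_ge1Dx _); rewrite lerDr.
Qed.

(** Clearing the denominator leaves the factor [y * (1 - x)] on the exponential, and it is at most
    1. *)
Lemma le_fab (R : realType) (a b x y : R) : `[0, 1]%classic x ->
  `[0, 1]%classic y -> expR (a * (x - b)) <= x * (1 - y) -> y <= fab a b x.
Proof.
move=> x01 y01 Exy; rewrite /fab ler_pdivlMr ?fab_den_gt0 //.
move: x01 y01; rewrite /= !in_itv /= => /andP[x0 x1] /andP[y0 y1].
suff : y * (1 - x) * expR (a * (x - b)) <= expR (a * (x - b)) by lra.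
rewrite ler_piMl ?expR_ge0 // mulr_ile1 ?subr_ge0 //; lra.
Qed.

Lemma fab_le (R : realType) (a b x y : R) : `[0, 1]%classic x -> 0 <= y ->
  x <= y * ((1 - x) * expR (a * (x - b))) -> fab a b x <= y.
Proof.
move=> x01 y0 xE; rewrite /fab ler_pdivrMr ?fab_den_gt0 //.
move: x01; rewrite /= in_itv /= => /andP[x0 x1].
rewrite mulrDr (le_trans xE) // lerDr mulr_ge0 //.
Qed.

(** The reflection inverts the exponential; multiplying numerator and denominator by it gives equal
    fractions. *)
Lemma fab_sym (R : realType) (a b x : R) : `[0, 1]%classic x ->
  fab a b (1 - x) = 1 - fab a (1 - b) x.
Proof.
move=> x01.
have x01' : `[0, 1]%classic (1 - x).
  by move: x01; rewrite /= !in_itv /= => /andP[? ?]; apply/andP; split; lra.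
have := fab_den_gt0 a b x01'; have := fab_den_gt0 a (1 - b) x01; rewrite /fab.
have -> : a * (1 - x - b) = - (a * (x - (1 - b))) by ring.
rewrite expRN; have := expR_gt0 (a * (x - (1 - b))).
set E := expR _ => E0 D1 D2.
have D2E : E * (1 - x) + x = E * (1 - x + (1 - (1 - x)) / E) by field; lra.
have D3 : 0 < E * (1 - x) + x by rewrite D2E mulr_gt0.
by field; rewrite ?gt_eqF //; lra.
Qed.

(** The witness is k = exp(-a/2). It must exceed f(q), of order exp(-a(3/4 - b/2)), and be small
    against exp(-ab) so that f(k) is small. Both hold since b < 1/2 < 3/4 - b/2. *)
Lemma fab_near_horseshoe (R : realType) (b : R) : 0 < b -> b < 1 / 2 ->
  let p := b / 2 in let q := 3 / 4 + b / 2 in let l := b / 4 in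
  \forall a \near +oo, exists k,
    [/\ 0 <= k, k <= l, q <= fab a b p, fab a b q <= k &
        fab a b k <= p /\ q <= fab a b l].
Proof.
move=> b0 b2 p q l.
have [pE qE lE] : [/\ p = b / 2, q = 3 / 4 + b / 2 & l = b / 4] by [].
clearbody p q l.
have [p0 p1 p01] : [/\ 0 < p, p <= 1 & `[0, 1]%classic p].
  by rewrite /= in_itv /=; split; lra.
have [q0 q1 q01] : [/\ 0 < q, q < 1 & `[0, 1]%classic q].
  by rewrite /= in_itv /=; split; lra.
have [l0 l01] : 0 < l /\ `[0, 1]%classic l by rewrite /= in_itv /=; split; lra.
have [l2 b3] : l <= 2^-1 /\ 0 < 3 / 4 * b by split; lra.
have [bp bq] : 0 < 1 / 2 - b /\ 0 < 1 / 4 - b / 2 by split; lra.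
have [pq lq] : 0 < p * (1 - q) /\ 0 < l * (1 - q) by rewrite !mulr_gt0 ?subr_gt0.
near=> a.
have a0 : 0 <= a by near: a; exact: nbhs_pinfty_ge.
have : expR (- (a * 2^-1)) <= l.
  by near: a; apply: near_pinfty_expRN_le; rewrite ?invr_gt0.
set k := expR _ => kl; exists k.
have k0 : 0 < k by exact: expR_gt0.
have k2 : k <= 2^-1 by exact: le_trans l2.
have k01 : `[0, 1]%classic k by rewrite /= in_itv /= ltW //=; clear -k2; lra.
split=> //; first exact: ltW.
- apply: le_fab => //.
  have -> : a * (p - b) = - (a * (b / 2)) by rewrite {1}pE; field.
  by near: a; apply: near_pinfty_expRN_le; rewrite ?divr_gt0.
- apply: fab_le; rewrite ?(ltW k0) //.
  have kE : k * expR (a * (q - b)) = (expR (- (a * (1 / 4 - b / 2))))^-1.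
    by rewrite -expRN -expRD opprK; congr expR; rewrite qE; field.
  rewrite mulrCA kE ler_pdivlMr ?expR_gt0 //.
  have : expR (- (a * (1 / 4 - b / 2))) <= 1 - q.
    by near: a; apply: near_pinfty_expRN_le; [|rewrite subr_gt0].
  by apply: le_trans; rewrite ler_piMl ?expR_ge0 // ltW.
- split.
    apply: fab_le; rewrite ?(ltW p0) //.
    have Eb : expR (- (a * b)) <= expR (a * (k - b)).
      by rewrite ler_expR mulrBr lerDr mulr_ge0 ?(ltW k0).
    have kE : k = expR (- (a * (1 / 2 - b))) * expR (- (a * b)).
      by rewrite -expRD /k; congr expR; field.
    (* The half absorbs the factor [1 - k], which is at least 1/2. *)
    have small : expR (- (a * (1 / 2 - b))) <= p / 2.
      by near: a; apply: near_pinfty_expRN_le; rewrite ?divr_gt0.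
    rewrite {1}kE mulrA; apply: ler_pM; rewrite ?expR_ge0 //.
    apply: le_trans small _; rewrite ler_wpM2l ?(ltW p0) //.
    by clear -k2; lra.
  apply: le_fab => //.
  have -> : a * (l - b) = - (a * (3 / 4 * b)) by rewrite {1}lE; field.
  by near: a; apply: near_pinfty_expRN_le.
Unshelve. all: by end_near.
Qed.

(** * Extension of [fab] to a continuous map of the real line *)

Section FabClamp.
Variables (R : realType) (a b : R).

(** The horseshoe results ask for continuity on the whole line, but the denominator of [fab] can
    vanish outside [0, 1]. Precomposing with this retraction changes no orbit that starts in
    [0, 1]. *)
Definition clamp01 (x : R) : R := Num.max 0 (Num.min 1 x).

Lemma clamp01_itv x : `[0, 1]%classic (clamp01 x).
Proof. by rewrite /= in_itv /= le_max lexx ge_max ler01 ge_min lexx. Qed.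

Lemma clamp01_id x : `[0, 1]%classic x -> clamp01 x = x.
Proof.
by rewrite /= in_itv /= => /andP[x0 x1]; rewrite /clamp01 (min_idPr x1) (max_idPr x0).
Qed.

Lemma continuous_clamp01 : continuous clamp01.
Proof.
apply: (@max_fun_continuous _ R R (cst 0) (fun x => Num.min 1 x)).
  by move=> x; exact: cvg_cst.
apply: (@min_fun_continuous _ R R (cst 1) id) => x; last exact: cvg_id.
exact: cvg_cst.
Qed.

Lemma continuous_fab_clamp : continuous (fab a b \o clamp01).
Proof.
move=> x; apply: (@cvg_comp _ _ _ clamp01 (fab a b) _
  (within `[0, 1] (nbhs (clamp01 x)))).
  move=> B nB.
  have nB' : nbhs x [set y | `[0, 1]%classic (clamp01 y) -> B (clamp01 y)].
    exact: continuous_clamp01 nB.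
  by apply: filterS nB' => y; apply; exact: clamp01_itv.
by have /subspace_continuousP := @fab_continuous R a b; apply; exact: clamp01_itv.
Qed.

Lemma iter_fab_clamp n x : `[0, 1]%classic x ->
  iter n (fab a b \o clamp01) x = iter n (fab a b) x.
Proof.
move=> x01; suff [] : iter n (fab a b \o clamp01) x = iter n (fab a b) x /\
  `[0, 1]%classic (iter n (fab a b) x) by [].
elim: n => [//|n [IH itv]]; rewrite !iterS IH /= clamp01_id //; split=> //.
exact: fab_set_fun.
Qed.

Lemma chaotic_of_horseshoe (p q k l : R) : 0 <= p -> q <= 1 ->
  horseshoe (fab a b \o clamp01) p q k l ->
  (forall n : nat, (1 <= n)%N ->
    exists O : set R, periodic_orbit `[0, 1] (fab a b) n O) /\
  li_yorke_chaotic (fun x y : R => `|x - y|) `[0, 1] (fab a b).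
Proof.
move=> p0 q1 hf.
have sub : `[p, q] `<=` `[0, 1].
  move=> x; rewrite /= !in_itv /= => /andP[px xq].
  by rewrite (le_trans p0) // (le_trans xq).
split.
  move=> n n0.
  have [x [/sub x01 fx nfx]] := horseshoe_periodic continuous_fab_clamp hf n0.
  exists [set iter k (fab a b) x | k in `I_n], x; split=> //.
    by rewrite -iter_fab_clamp.
  by move=> i /nfx; rewrite iter_fab_clamp.
have [S [SJ Sunc LY]] := horseshoe_scrambled continuous_fab_clamp hf.
exists S; split=> [|//|x y Sx Sy xy]; first exact: subset_trans sub.
rewrite /li_yorke_pair.
suff <- : (fun n =>
    `|iter n (fab a b \o clamp01) x - iter n (fab a b \o clamp01) y|%:E) =
  (fun n => `|iter n (fab a b) x - iter n (fab a b) y|%:E) by exact: LY.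
by apply/funext => n; rewrite !iter_fab_clamp //; [apply/sub/SJ|apply/sub/SJ].
Qed.

End FabClamp.

(** * The cases b < 1/2 and b > 1/2 *)

Theorem corollary3p12 (R : realType) (b : R) (hb : b \in `]0, 1[)
    (hb2 : b <> 1 / 2) :
  exists a_b : R, forall a : R, 0 < a -> a_b < a ->
    (forall n : nat, (1 <= n)%N ->
      exists O : set R, periodic_orbit `[0, 1] (fab a b) n O) /\
    li_yorke_chaotic (fun x y : R => `|x - y|) `[0, 1] (fab a b).
Proof.
move: hb; rewrite in_itv /= => /andP[b0 b1].
have cf a := @continuous_fab_clamp R a b.
have [blt|bgt|//] := ltgtP b (1 / 2).
  have [a_b [_ H]] := fab_near_horseshoe b0 blt; exists a_b => a _ /H.
  move=> [k [k0 kl pq qk [kp lq]]].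
  have fE x : 0 <= x -> x <= 1 -> (fab a b \o @clamp01 R) x = fab a b x.
    by move=> x0 x1 /=; rewrite clamp01_id //= in_itv /= x0.
  apply: (@chaotic_of_horseshoe R a b (b / 2) (3 / 4 + b / 2) k (b / 4)); try lra.
  split; try lra.
  (* On J the values pass from at least [q] down to at most [k], which covers both J and K. *)
  - by apply: (IVT_image_decr (cf a)); rewrite ?fE //; lra.
  - by apply: (IVT_image_decr (cf a)); rewrite ?fE //; lra.
  - by apply: (IVT_image (cf a)); rewrite ?fE //; lra.
have b'0 : 0 < 1 - b by lra.
have b'lt : 1 - b < 1 / 2 by lra.
have [a_b [_ H]] := fab_near_horseshoe b'0 b'lt; exists a_b => a _ /H.
move=> [k [k0 kl pq qk [kp lq]]].
have fE x : 0 <= x -> x <= 1 -> (fab a b \o @clamp01 R) (1 - x) =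
    1 - fab a (1 - b) x.
  move=> x0 x1 /=; rewrite clamp01_id ?fab_sym //= in_itv /=; first by rewrite x0.
  by apply/andP; split; lra.
(* The horseshoe for [1 - b] is reflected, so the endpoints of each interval swap. *)
apply: (@chaotic_of_horseshoe R a b (1 - (3 / 4 + (1 - b) / 2)) (1 - (1 - b) / 2)
  (1 - (1 - b) / 4) (1 - k)); try lra.
split; try lra.
- by apply: (IVT_image_decr (cf a)); rewrite ?fE //; lra.
- by apply: (IVT_image_decr (cf a)); rewrite ?fE //; lra.
- by apply: (IVT_image (cf a)); rewrite ?fE //; lra.
Qed.
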